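(* Let $F,B,X,\sigma,\rho,x_0$ be as in the context (so $\sigma\in(0,1)$, $\rho\in[0,\frac12)$). Suppose that $\operatorname{Sol}(F,B)\ne\emptyset$ and that $F$ is globally Lipschitz continuous with constant $L>0$. Let the MAEG method be run with the fixed stepsizes $\lambda_k=\sigma/L$ for all $k\ge1$. Then the MAEG method achieves an $\mathcal{O}(1/k)$ iteration complexity with respect to both the composite natural residual and the reduced gradient norm, i.e. $\|\mathcal{R}^c_{\mathrm{nat}}(y_k)\|=\mathcal{O}(1/k)$ and $\|d_k\|=\mathcal{O}(1/k)$.
   Context: Problem: $F:\operatorname{dom}F\subseteq\mathbb{R}^n\to\mathbb{R}^n$ is a monotone, continuous (single-valued) operator and $B:\mathbb{R}^n\rightrightarrows\mathbb{R}^n$ is a set-valued maximal monotone operator with $\operatorname{cl}(\operatorname{dom}B)\subseteq\operatorname{dom}F$. $\operatorname{Sol}(F,B)=\{x: 0\in F(x)+B(x)\}$. $\Pi_C$ is the Euclidean projection onto a nonempty closed convex set $C$, and $J_{T}=(\operatorname{Id}+T)^{-1}$ is the resolvent. The composite natural residual is $\mathcal{R}^c_{\mathrm{nat}}(x)=x-J_B(x-F(x))$, $x\in\operatorname{dom}F$; the reduced gradient norm at iteration $k$ is $\|d_k\|$ with $d_k$ defined below. MAEG method. Input: $x_0\in\operatorname{cl}(\operatorname{dom}B)$, $\sigma\in(0,1)$, $\rho\in[0,\frac12)$, and a nonempty closed convex set $X$ with $\operatorname{cl}(\operatorname{dom}B)\subseteq X\subseteq\operatorname{dom}F$. Initialize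 $u_0=y_0=x_0$, $d_0=0$, $\Lambda_0=0$. For $k=1,2,\dots$: $$x_k=\Pi_X\bigl(\tau_ku_{k-1}+(1-\tau_k)(y_{k-1}-\lambda_kd_{k-1})\bigr),\qquad y_k=J_{\lambda_kB}\bigl(\tau_ku_{k-1}+(1-\tau_k)y_{k-1}-\lambda_kF(x_k)\bigr),$$ where $\tau_k=\frac{\lambda_k}{(1-2\rho)\Lambda_{k-1}+\lambda_k}$, $\Lambda_k=\sum_{i=1}^k\lambda_i$, and $\lambda_k>0$ is chosen so that $\lambda_k\|F(x_k)-F(y_k)\|\le\sigma\|x_k-y_k\|$ (automatically satisfied for $\lambda_k=\sigma/L$); then $$d_k=\tfrac1{\lambda_k}\bigl(\tau_ku_{k-1}+(1-\tau_k)y_{k-1}-y_k\bigr)-F(x_k)+F(y_k),\qquad u_k=u_{k-1}-\rho\lambda_kd_k .$$ *)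

(* Defs.v *)
From HB Require Import structures.
From mathcomp Require Import all_boot all_order all_algebra.
From mathcomp Require Import all_classical all_reals all_analysis.

Set Implicit Arguments.
Unset Strict Implicit.
Unset Printing Implicit Defensive.

Import Order.TTheory GRing.Theory Num.Theory.
Import numFieldNormedType.Exports.

Local Open Scope classical_set_scope.
Local Open Scope ring_scope.

(* The topology that the library puts on 'rV[R]_n comes from the sup norm `|x|;
   it coincides with the Euclidean one, but distances must not be measured
   with `|x|, hence enorm. *)
Definition dotr (R : realType) (n : nat) (x y : 'rV[R]_n) : R :=
  \sum_(i < n) x 0 i * y 0 i.

Definition enorm (R : realType) (n : nat) (x : 'rV[R]_n) : R :=
  Num.sqrt (dotr x x).

(* A set-valued operator maps a point to the set of its images. *)
Definition setop (R : realType) (n : nat) := 'rV[R]_n -> set 'rV[R]_n.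

Definition sdom (R : realType) (n : nat) (T : setop R n) : set 'rV[R]_n :=
  [set x | T x !=set0].

Definition smonotone (R : realType) (n : nat) (T : setop R n) : Prop :=
  forall x y u v, T x u -> T y v -> 0 <= dotr (u - v) (x - y).

(* Maximality is with respect to inclusion of graphs. *)
Definition maximal_monotone (R : realType) (n : nat) (T : setop R n) : Prop :=
  smonotone T /\
  forall S : setop R n, smonotone S -> (forall x, T x `<=` S x) ->
    forall x, S x `<=` T x.

Definition sscale (R : realType) (n : nat) (c : R) (T : setop R n) : setop R n :=
  fun x => [set c *: t | t in T x].

(* A single-valued operator with domain D is a total function of which only the
   values on D matter. *)
Definition monotone_on (R : realType) (n : nat) (D : set 'rV[R]_n)
    (F : 'rV[R]_n -> 'rV[R]_n) : Prop :=
  forall x y, D x -> D y -> 0 <= dotr (F x - F y) (x - y).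

Definition elipschitz_on (R : realType) (n : nat) (L : R) (D : set 'rV[R]_n)
    (F : 'rV[R]_n -> 'rV[R]_n) : Prop :=
  forall x y, D x -> D y -> enorm (F x - F y) <= L * enorm (x - y).

Definition Sol (R : realType) (n : nat) (D : set 'rV[R]_n)
    (F : 'rV[R]_n -> 'rV[R]_n) (B : setop R n) : set 'rV[R]_n :=
  [set x | D x /\ exists2 b, B x b & 0 = F x + b].

(* [get A] is a chosen element of A. For a nonempty closed convex C the set of
   nearest points is a singleton. *)
Definition eproj (R : realType) (n : nat) (C : set 'rV[R]_n) (x : 'rV[R]_n) :
    'rV[R]_n :=
  get [set p | C p /\ forall q, C q -> enorm (x - p) <= enorm (x - q)].

(* (Id + T)^-1 as a set-valued operator; by Minty's theorem it is single-valued
   and everywhere defined when T is maximal monotone, so that [resolvent T z] is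
   then its unique value at z. *)
Definition sresolvent (R : realType) (n : nat) (T : setop R n) : setop R n :=
  fun z => [set y | exists2 t, T y t & z = y + t].

Definition resolvent (R : realType) (n : nat) (T : setop R n) (z : 'rV[R]_n) :
    'rV[R]_n :=
  get (sresolvent T z).

Definition cnat_residual (R : realType) (n : nat) (F : 'rV[R]_n -> 'rV[R]_n)
    (B : setop R n) (x : 'rV[R]_n) : 'rV[R]_n :=
  x - resolvent B (x - F x).

Section MAEG.

Variables (R : realType) (n : nat).
Variables (F : 'rV[R]_n -> 'rV[R]_n) (B : setop R n) (X : set 'rV[R]_n).
Variables (rho : R) (lam : nat -> R) (x0 : 'rV[R]_n).

(* Stepsizes are numbered from 1; lam 0 is never used. *)
Definition maeg_Lambda (k : nat) : R := \sum_(1 <= i < k.+1) lam i.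

Definition maeg_tau (k : nat) : R :=
  lam k / ((1 - 2 * rho) * maeg_Lambda k.-1 + lam k).

(* The triple (u_k, y_k, d_k); x_{k+1} is a function of it. *)
Record maeg_state : Type := MaegState {
  state_u : 'rV[R]_n;
  state_y : 'rV[R]_n;
  state_d : 'rV[R]_n }.

(* From (u_{k-1}, y_{k-1}, d_{k-1}) to (u_k, y_k, d_k). The requirement
   lam k * enorm (F x - F y) <= sigma * enorm (x - y) of the method restricts
   the choice of lam k and does not enter the update; when F is L-Lipschitz it
   holds for lam k = sigma / L whatever x and y are. *)
Definition maeg_step (k : nat) (s : maeg_state) : maeg_state :=
  let: MaegState u y d := s in
  let t := maeg_tau k in
  let x' := eproj X (t *: u + (1 - t) *: (y - lam k *: d)) in
  let y' := resolvent (sscale (lam k) B)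
              (t *: u + (1 - t) *: y - lam k *: F x') in
  let d' := (lam k)^-1 *: (t *: u + (1 - t) *: y - y') - F x' + F y' in
  let u' := u - (rho * lam k) *: d' in
  MaegState u' y' d'.

Fixpoint maeg (k : nat) : maeg_state :=
  if k is j.+1 then maeg_step k (maeg j) else MaegState x0 x0 0.

Definition maeg_y (k : nat) : 'rV[R]_n := state_y (maeg k).

Definition maeg_d (k : nat) : 'rV[R]_n := state_d (maeg k).

End MAEG.

(* Main.v *)
Require Import Defs.
From mathcomp Require Import all_boot all_order all_algebra.
From mathcomp Require Import all_classical all_reals all_analysis.
From mathcomp Require Import ring lra.
Import Order.TTheory GRing.Theory Num.Theory.
Import numFieldNormedType.Exports.
Local Open Scope classical_set_scope.
Local Open Scope ring_scope.

(** Write a = 1 - 2 * rho and lambda = sigma / L, so that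
    tau_(k+1) = 1 / (a k + 1). The proof has three ingredients.

    - A Lyapunov inequality. Each d_k with k >= 1 lies in F(y_k) + B(y_k), so
      the monotonicity of F + B can be used between consecutive iterates.
      Together with the Lipschitz bound on the extragradient error
      lambda (F(x_k) - F(y_k)) it gives, by induction,
        (lambda / 2) a k |d_k|^2 <= <d_k, u_k - y_k>.
      Monotonicity between y_k and a solution x* then shows first that
      |u_k - x*| is nonincreasing, and second that the right-hand side is at
      most |d_k| |u_k - x*|. Hence |d_k| <= 2 |x_0 - x*| / (lambda a k).
      See [maeg_step_descent], [maeg_update] and [maeg_gradient_le].

    - The residual is dominated by the reduced gradient: y_k is the resolvent
      of B at y_k - F(y_k) + d_k, and resolvents are nonexpansive
      ([cnat_residual_le]).

    - Projections and resolvents exist. Both facts come from the maximization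
      of the strongly concave function h - |c|^2 over a convex set of pairs
      (c, h) ([strongly_concave_max]): maximizing sequences are Cauchy in c, and
      the first-order condition at the limit yields the obtuse angle property of
      the projection ([eprojP]) as well as the point required by the theorem of
      Minty ([minty]). In the latter case the required upper bound on the
      function follows from the inequality <v, x> <= a, which monotonicity
      gives for all points (x, v, a) of the convex hull of the points
      (x, v, <v, x>) over the graph ([graph_hull_ge]). *)

Set Implicit Arguments.
Unset Strict Implicit.
Unset Printing Implicit Defensive.

(** * The Euclidean inner product *)

Lemma dotrC (R : realType) (n : nat) (x y : 'rV[R]_n) : dotr x y = dotr y x.
Proof. by apply: eq_bigr => i _; rewrite mulrC. Qed.

Lemma dotrDl (R : realType) (n : nat) (x y z : 'rV[R]_n) :
  dotr (x + y) z = dotr x z + dotr y z.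
Proof. by rewrite -big_split; apply: eq_bigr => i _; rewrite mxE mulrDl. Qed.

Lemma dotrZl (R : realType) (n : nat) (a : R) (x y : 'rV[R]_n) :
  dotr (a *: x) y = a * dotr x y.
Proof. by rewrite mulr_sumr; apply: eq_bigr => i _; rewrite mxE mulrA. Qed.

Lemma dotrDr (R : realType) (n : nat) (x y z : 'rV[R]_n) :
  dotr x (y + z) = dotr x y + dotr x z.
Proof. by rewrite !(dotrC x) dotrDl. Qed.

Lemma dotrZr (R : realType) (n : nat) (a : R) (x y : 'rV[R]_n) :
  dotr x (a *: y) = a * dotr x y.
Proof. by rewrite !(dotrC x) dotrZl. Qed.

Lemma dotrNl (R : realType) (n : nat) (x y : 'rV[R]_n) :
  dotr (- x) y = - dotr x y.
Proof. by rewrite -scaleN1r dotrZl mulN1r. Qed.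

Lemma dotrNr (R : realType) (n : nat) (x y : 'rV[R]_n) :
  dotr x (- y) = - dotr x y.
Proof. by rewrite !(dotrC x) dotrNl. Qed.

Lemma dotr0l (R : realType) (n : nat) (x : 'rV[R]_n) : dotr 0 x = 0.
Proof. by rewrite -(scale0r 0) dotrZl mul0r. Qed.

Definition dotrE := (dotrDl, dotrDr, dotrNl, dotrNr, dotrZl, dotrZr).

Lemma dotr_ge0 (R : realType) (n : nat) (x : 'rV[R]_n) : 0 <= dotr x x.
Proof. by apply: sumr_ge0 => i _; rewrite -expr2 sqr_ge0. Qed.

Lemma sqr_coord_le_dotr (R : realType) (n : nat) (x : 'rV[R]_n) (i : 'I_n) :
  x 0 i ^+ 2 <= dotr x x.
Proof.
rewrite /dotr (bigD1 i) //= -expr2 lerDl.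
by apply: sumr_ge0 => j _; rewrite -expr2 sqr_ge0.
Qed.

Lemma dotr_le0_eq0 (R : realType) (n : nat) (x : 'rV[R]_n) : dotr x x <= 0 -> x = 0.
Proof.
move=> x0; apply/rowP => i; rewrite mxE; apply/eqP; rewrite -sqrf_eq0 eq_le.
by rewrite sqr_ge0 (le_trans (sqr_coord_le_dotr x i)).
Qed.

Lemma enorm_ge0 (R : realType) (n : nat) (x : 'rV[R]_n) : 0 <= enorm x.
Proof. exact: sqrtr_ge0. Qed.

Lemma sqr_enorm (R : realType) (n : nat) (x : 'rV[R]_n) :
  enorm x ^+ 2 = dotr x x.
Proof. by rewrite sqr_sqrtr ?dotr_ge0. Qed.

Lemma ler_enorm (R : realType) (n : nat) (x y : 'rV[R]_n) :
  (enorm x <= enorm y) = (dotr x x <= dotr y y).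
Proof. by rewrite ler_sqrt ?dotr_ge0. Qed.

Lemma cauchy_schwarz (R : realType) (n : nat) (x y : 'rV[R]_n) :
  dotr x y <= enorm x * enorm y.
Proof.
have [x0|x0] := eqVneq (enorm x) 0.
  suff -> : x = 0 by rewrite dotr0l mulr_ge0 ?enorm_ge0.
  by apply: dotr_le0_eq0; rewrite -sqr_enorm x0 expr0n.
have [y0|y0] := eqVneq (enorm y) 0.
  suff -> : y = 0 by rewrite dotrC dotr0l mulr_ge0 ?enorm_ge0.
  by apply: dotr_le0_eq0; rewrite -sqr_enorm y0 expr0n.
have xy0 : 0 < enorm x * enorm y by rewrite mulr_gt0 ?lt0r ?x0 ?y0 ?enorm_ge0.
have := dotr_ge0 (enorm y *: x - enorm x *: y).
rewrite !dotrE (dotrC y x) -!sqr_enorm => h.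
rewrite -(ler_pM2l xy0); nra.
Qed.

Lemma dotr_continuous (R : realType) (n : nat) (a : 'rV[R]_n) :
  continuous (fun x : 'rV[R]_n => dotr (a - x) (a - x)).
Proof.
have cx (i : 'I_n) : continuous (fun x : 'rV[R]_n => (a - x) 0 i).
  rewrite (_ : (fun x => _) = (fun x : 'rV[R]_n => a 0 i - x 0 i)); last first.
    by apply/funext => x; rewrite !mxE.
  move=> x; have := @coord_continuous R 1 n 0 i x.
  move=> h; apply: continuousB; [exact: cst_continuous|exact: h].
rewrite /dotr; apply: continuous_big => [|i _]; first exact: add_continuous.
by move=> x; apply: continuousM; exact: cx.
Qed.

(** * Maximizing a strongly concave function *)

(** Cantor's intersection theorem: the sets A e form a filter base, which is
    Cauchy because their diameters tend to 0, and its limit is the point. *)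
Lemma cantor_closure (R : realType) (n : nat) (A : R -> set 'rV[R]_n) :
  (forall e, 0 < e -> A e !=set0) ->
  (forall e f, e <= f -> A e `<=` A f) ->
  (forall e c c', 0 < e -> A e c -> A e c' -> dotr (c - c') (c - c') <= e) ->
  exists y, forall e, 0 < e -> closure (A e) y.
Proof.
move=> A0 Amono Adiam.
pose G := filter_from [set e : R | 0 < e] A.
have GG : ProperFilter G.
  apply: filter_from_proper => [|e e0]; last exact: A0.
  apply: filter_from_filter; first by exists 1 => /=.
  move=> e f e0 f0; exists (Num.min e f) => /=; first by rewrite lt_min e0.
  by move=> c Ac; split; apply: Amono Ac; rewrite ge_min lexx ?orbT.
have Gc : cauchy G.
  apply: cauchy_exP => e e0.
  have e20 : 0 < e ^+ 2 / 4 by rewrite divr_gt0 ?exprn_gt0.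
  have [c Ac] := A0 _ e20; exists c, (e ^+ 2 / 4) => //= c' Ac'.
  split=> // i j; rewrite /ball/= (ord1 i).
  have := le_trans (sqr_coord_le_dotr (c - c') j) (Adiam _ _ _ e20 Ac Ac').
  rewrite !mxE => h; rewrite -ltr_sqr ?nnegrE ?normr_ge0 ?ltW //.
  rewrite real_normK ?num_real //.
  apply: le_lt_trans h _; rewrite ltr_pdivrMr//; have := e0; nra.
have Gy : G --> lim G := cauchy_cvg _ Gc.
exists (lim G) => e e0 U /Gy [f f0 fU].
have [c Ac] := A0 (Num.min e f) ltac:(by rewrite lt_min e0).
exists c; split; first by apply: Amono Ac; rewrite ge_min lexx.
by apply: fU; apply: Amono Ac; rewrite ge_min lexx orbT.
Qed.

(** Closed Euclidean balls are closed for the sup-norm topology; this is how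
    bounds pass to limit points below. *)
Lemma closure_dotr_le (R : realType) (n : nat) (A : set 'rV[R]_n)
    (a y : 'rV[R]_n) (r : R) :
  (forall c, A c -> dotr (a - c) (a - c) <= r) -> closure A y ->
  dotr (a - y) (a - y) <= r.
Proof.
move=> Ar; have cl : closed [set c : 'rV[R]_n | dotr (a - c) (a - c) <= r].
  apply: (@closed_comp _ _ (fun c : 'rV[R]_n => dotr (a - c) (a - c))
    [set z | z <= r]); last exact: closed_le.
  by move=> c _; exact: dotr_continuous.
by move=> /(closure_subset Ar); rewrite -(closure_id _).1.
Qed.

(** Let s be the supremum of h - |c|^2. Strong concavity along the segment from
    a near-maximizer (c', h') to any (c, h) bounds |c - c'|^2. When (c, h) is a
    near-maximizer too, this says that near-maximizers have small diameter, so
    their first components converge to some y; for arbitrary (c, h) it becomes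
    in the limit h - |c|^2 + |c - y|^2 <= s, the first-order condition. *)
Lemma strongly_concave_max (R : realType) (n : nat)
    (C : 'rV[R]_n -> R -> Prop) (M : R) :
  (exists c h, C c h) ->
  (forall t c h c' h', 0 < t < 1 -> C c h -> C c' h' ->
     C (t *: c + (1 - t) *: c') (t * h + (1 - t) * h')) ->
  (forall c h, C c h -> h - dotr c c <= M) ->
  exists y s, [/\ s <= M,
    forall e, 0 < e ->
      closure [set c | exists2 h, C c h & s - e < h - dotr c c] y &
    forall c h, C c h -> h - 2 * dotr y c + dotr y y <= s].
Proof.
move=> [c0 [h0 C0]] Cconv CM.
pose V := [set r | exists c h, C c h /\ r = h - dotr c c].
have V0 : V !=set0 by exists (h0 - dotr c0 c0), c0, h0.
have VM : ubound V M by move=> _ [c [h [? ->]]]; exact: CM.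
have supV : has_sup V by split=> //; exists M.
have leV c h : C c h -> h - dotr c c <= sup V.
  by move=> Cch; apply: sup_upper_bound => //; exists c, h.
(* Compare the value at t (c, h) + (1 - t) (c', h') with the supremum. *)
have key t e c h c' h' : 0 < t < 1 -> C c h -> C c' h' ->
    sup V - e < h' - dotr c' c' ->
    t * (h - dotr c c + (1 - t) * dotr (c - c') (c - c')) <= t * sup V + e.
  move=> t01 Cc Cc' lte; have := leV _ _ (Cconv _ _ _ _ _ t01 Cc Cc').
  rewrite !dotrE (dotrC c' c); move: lte (leV _ _ Cc'); set s := sup V.
  set p := dotr c c; set q := dotr c c'; set r := dotr c' c' => lte le H.
  have : 0 <= t * (h' - r - (s - e)) by rewrite mulr_ge0 ?subr_ge0; lra.
  nra.
pose A e := [set c | exists2 h, C c h & sup V - e < h - dotr c c].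
(* Taking t = 1/2 below, e / 8 is small enough for a squared diameter of at
   most e. *)
have [y Ay] : exists y, forall e, 0 < e -> closure (A (e / 8)) y.
  apply: (@cantor_closure R n (fun e => A (e / 8))).
  - move=> e e0; have [r [c [h [Cc ->]]] lte] :
        exists2 r, V r & sup V - e / 8 < r.
      by apply: sup_adherent => //; lra.
    by exists c, h.
  - by move=> e f ef c [h Cc lte]; exists h => //; lra.
  - move=> e c c' e0 [h Cc lte] [h' Cc' lte'].
    have := key 2^-1 _ _ _ _ _ ltac:(lra) Cc Cc' lte'; lra.
have {}Ay e : 0 < e -> closure (A e) y.
  by move=> e0; have := Ay (e * 8) ltac:(lra); rewrite mulfK.
exists y, (sup V); split => //; first exact: ge_sup.
move=> c h Cc.
have step t e : 0 < t < 1 -> 0 < e ->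
    t * (h - dotr c c + (1 - t) * dotr (c - y) (c - y)) <= t * sup V + e.
  move=> t01 e0; have t1 : 0 < t * (1 - t) by rewrite mulr_gt0; lra.
  have : dotr (c - y) (c - y) <=
      (t * sup V + e - t * (h - dotr c c)) / (t * (1 - t)).
    apply: closure_dotr_le (Ay e e0) => c' [h' Cc' lte'].
    rewrite ler_pdivlMr //; have := key _ _ _ _ _ _ t01 Cc Cc' lte'; lra.
  rewrite ler_pdivlMr //; lra.
rewrite [leLHS](_ : _ = h - dotr c c + dotr (c - y) (c - y)); last first.
  by rewrite !dotrE (dotrC c y); ring.
have N0 := dotr_ge0 (c - y).
set N := dotr (c - y) (c - y) in N0 step *.
apply/ler_addgt0Pr => e e0.
(* Let t tend to 0: the choice t = e / (2 (e + N)) leaves an error of at most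
   t N <= e / 2, plus e / 2 from the near-maximality level t * (e / 2). *)
have eN : 0 < 2 * (e + N) by lra.
have tP : 0 < e / (2 * (e + N)) < 1.
  by rewrite divr_gt0 //= ltr_pdivrMr //; lra.
set t := e / _ in tP.
have tN : t * (2 * (e + N)) = e by rewrite divfK // gt_eqF.
have t0 : 0 < t by case/andP: tP.
have := step t (t * (e / 2)) tP ltac:(by rewrite mulr_gt0 ?divr_gt0).
rewrite -mulrDr ler_pM2l //; nra.
Qed.

(** * Projections *)

(** The case h = 0 of [strongly_concave_max], with c = x - q for q in X: then
    h - |c|^2 = - |x - q|^2, and the first-order condition is the obtuse angle
    property. *)
Lemma obtuse_angle_point (R : realType) (n : nat) (X : set 'rV[R]_n)
    (x : 'rV[R]_n) :
  X !=set0 -> closed X -> convex_set X ->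
  exists2 p, X p & forall q, X q -> 0 <= dotr (x - p) (p - q).
Proof.
move=> [q0 Xq0] Xcl Xcv.
have conv t q q' : 0 < t < 1 -> X q -> X q' -> X (t *: q + (1 - t) *: q').
  move=> /andP[t0 t1] Xq Xq'; apply/set_mem.
  exact: (Xcv q q' (Itv01 (ltW t0) (ltW t1)) (mem_set Xq) (mem_set Xq')).
have [||c h [_ ->]|y [s [s0 yC ys]]] := @strongly_concave_max R n
    (fun c h => X (x - c) /\ h = 0) 0.
- by exists (x - q0), 0; rewrite subKr.
- move=> t c h c' h' t01 [Xc ->] [Xc' ->]; split; last by rewrite !mulr0 addr0.
  have := conv _ _ _ t01 Xc Xc'; congr X.
  by rewrite !scalerBr addrACA -scalerDl -opprD [t + _]addrC subrK scale1r.
- by rewrite sub0r oppr_le0 dotr_ge0.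
have Xy : X (x - y).
  have cl : closed [set c : 'rV[R]_n | X (x - c)].
    apply: (@closed_comp _ _ (fun c : 'rV[R]_n => x - c) X) => // c _.
    by apply: continuousB; [exact: cst_continuous|move=> ?].
  suff /closure_subset : [set c | exists2 h, X (x - c) /\ h = 0 &
      s - 1 < h - dotr c c] `<=` [set c | X (x - c)].
    by move=> /(_ _ (yC _ ltr01)); rewrite -(closure_id _).1.
  by move=> c [h []].
have ysq : dotr y y <= - s.
  apply/ler_addgt0Pr => e e0.
  have : dotr (0 - y) (0 - y) <= - s + e.
    apply: closure_dotr_le (yC e e0) => c [h [_ ->]].
    by rewrite !sub0r !dotrE; lra.
  by rewrite !sub0r !dotrE opprK.
exists (x - y) => // q Xq; have := ys (x - q) 0.
rewrite subKr; move=> /(_ (conj Xq erefl)).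
rewrite !subKr !dotrE; lra.
Qed.

(** The obtuse angle property gives a Pythagorean inequality, which makes its
    point the unique nearest point of X, hence the one chosen by [eproj]. *)
Lemma eprojP (R : realType) (n : nat) (X : set 'rV[R]_n) (x : 'rV[R]_n) :
  X !=set0 -> closed X -> convex_set X ->
  X (eproj X x) /\ forall q, X q -> 0 <= dotr (x - eproj X x) (eproj X x - q).
Proof.
move=> X0 Xcl Xcv; have [p Xp pX] := obtuse_angle_point x X0 Xcl Xcv.
have pyth q : X q ->
    dotr (x - p) (x - p) + dotr (p - q) (p - q) <= dotr (x - q) (x - q).
  move=> Xq; have := pX q Xq.
  rewrite !dotrE (dotrC q p) (dotrC p x) (dotrC q x); lra.
have [Xe emin] : [set p | X p /\
    forall q, X q -> enorm (x - p) <= enorm (x - q)] (eproj X x).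
  apply: getPex; exists p; split => // q Xq; rewrite ler_enorm.
  by apply: le_trans (pyth q Xq); rewrite lerDl dotr_ge0.
suff -> : eproj X x = p by [].
apply/eqP; rewrite eq_sym -subr_eq0; apply/eqP/dotr_le0_eq0.
have := pyth _ Xe; have := emin _ Xp; rewrite ler_enorm; lra.
Qed.

(** * Minty's theorem and resolvents *)

(** The convex hull of the points (x, v, <v, x>) with v in T x. Two-point
    convex combinations generate it, which replaces sums over finite families
    by inductions. *)
Inductive graph_hull (R : realType) (n : nat) (T : setop R n) :
    'rV[R]_n -> 'rV[R]_n -> R -> Prop :=
| graph_hull_point x v : T x v -> graph_hull T x v (dotr v x)
| graph_hull_conv t x v a x' v' a' : 0 < t < 1 ->
    graph_hull T x v a -> graph_hull T x' v' a' ->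
    graph_hull T (t *: x + (1 - t) *: x') (t *: v + (1 - t) *: v')
      (t * a + (1 - t) * a').

(** The expression a + b - <v, y> - <w, x> is affine in (x, v, a) and in
    (y, w, b), and for two points of the graph it is <v - w, x - y> >= 0. Hence
    it is nonnegative on the hull in each argument successively; on the
    diagonal it is 2 (a - <v, x>). *)
Lemma graph_hull_ge (R : realType) (n : nat) (T : setop R n)
    (x v : 'rV[R]_n) (a : R) :
  smonotone T -> graph_hull T x v a -> dotr v x <= a.
Proof.
move=> Tmono Hx.
have pt y w b x0 v0 : graph_hull T y w b -> T x0 v0 ->
    dotr w x0 + dotr v0 y <= b + dotr v0 x0.
  move=> Hy Tx0.
  elim: Hy => {y w b} [y w Tyw|t y w b y' w' b' /andP[t0 t1] _ IH _ IH'].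
    by have := Tmono _ _ _ _ Tyw Tx0; rewrite !dotrE; lra.
  by rewrite !dotrE; nra.
suff hull y w b : graph_hull T y w b -> dotr w x + dotr v y <= b + a.
  by have := hull _ _ _ Hx; lra.
move=> Hy.
elim: Hx => {x v a} [x0 v0 Tx0|t x v a x' v' a' /andP[t0 t1] _ IH _ IH'].
  exact: pt.
by rewrite !dotrE; nra.
Qed.

(** By maximality it suffices to find y such that z - y is monotonically
    related at y to the whole graph. With w = v - z and c = (x - w) / 2 the
    condition 0 <= <w + y, x - y> reads - <w, x> - 2 <y, c> + |y|^2 <= 0. It is
    the first-order condition of [strongly_concave_max] with h = - <w, x>, as
    soon as h <= |c|^2 on the convex hull. That bound follows from
    [graph_hull_ge] and |c|^2 + <w, x> = |x + w|^2 / 4. *)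
Lemma minty (R : realType) (n : nat) (T : setop R n) (z : 'rV[R]_n) :
  maximal_monotone T -> exists y, sresolvent T z y.
Proof.
move=> [Tmono Tmax].
suff [y yT] : exists y, forall x v, T x v -> 0 <= dotr (v - (z - y)) (x - y).
  pose S x v := T x v \/ x = y /\ v = z - y.
  have Smono : smonotone S.
    move=> x x' v v' [Tx|[-> ->]] [Tx'|[-> ->]].
    - exact: Tmono.
    - exact: yT.
    - by have := yT _ _ Tx'; rewrite !dotrE; lra.
    - by rewrite !subrr dotr0l.
  exists y, (z - y); last by rewrite subrKC.
  by apply: (Tmax S Smono) => [x v|]; [left|right].
have [[x0 [v0 T0]]|Tempty] := pselect (exists x v, T x v); last first.
  by exists 0 => x v Tx; case: Tempty; exists x, v.
pose C c h := exists x v a, [/\ graph_hull T x v a,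
  c = 2^-1 *: (x - (v - z)) & h = dotr z x - a].
have [|||y [s [s0 _ ys]]] := @strongly_concave_max R n C 0.
- exists (2^-1 *: (x0 - (v0 - z))), (dotr z x0 - dotr v0 x0).
  exists x0, v0, (dotr v0 x0); by split=> //; exact: graph_hull_point.
- move=> t _ _ _ _ t01 [x [v [a [Hx -> ->]]]] [x' [v' [a' [Hx' -> ->]]]].
  exists (t *: x + (1 - t) *: x'), (t *: v + (1 - t) *: v').
  exists (t * a + (1 - t) * a'); split; first exact: graph_hull_conv.
    by apply/rowP => i; rewrite !mxE; ring.
  by rewrite !dotrE; ring.
- move=> _ _ [x [v [a [Hx -> ->]]]]; have := graph_hull_ge Tmono Hx.
  have := dotr_ge0 (x + (v - z)).
  by rewrite !dotrE (dotrC x v) (dotrC x z) (dotrC z v); lra.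
exists y => x v Tx.
have Cx : C (2^-1 *: (x - (v - z))) (dotr z x - dotr v x).
  by exists x, v, (dotr v x); split => //; exact: graph_hull_point.
have := ys _ _ Cx.
by rewrite !dotrE (dotrC y x) (dotrC y v) (dotrC y z) (dotrC x y); lra.
Qed.

Lemma maximal_monotone_scale (R : realType) (n : nat) (c : R) (T : setop R n) :
  0 < c -> maximal_monotone T -> maximal_monotone (sscale c T).
Proof.
move=> c0 [Tmono Tmax]; have cn0 : c != 0 by rewrite gt_eqF.
split=> [x y _ _ [u Tu <-] [v Tv <-]|S Smono TS x v Sv].
  by rewrite -scalerBr dotrZl (mulr_ge0 (ltW c0)) ?Tmono.
exists (c^-1 *: v); last by rewrite scalerA divff ?scale1r.
apply: (Tmax (sscale c^-1 S)); last by exists v.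
- move=> x' y' _ _ [u Su <-] [w Sw <-].
  by rewrite -scalerBr dotrZl mulr_ge0 ?Smono ?invr_ge0 ?(ltW c0).
- move=> x' u Tu; exists (c *: u); first by apply: TS; exists u.
  by rewrite scalerA mulVf ?scale1r.
Qed.

Lemma resolventP (R : realType) (n : nat) (T : setop R n) (z : 'rV[R]_n) :
  maximal_monotone T -> T (resolvent T z) (z - resolvent T z).
Proof.
move=> Tmax; have [t Tt e] : sresolvent T z (resolvent T z).
  by apply: getPex; exact: minty.
by rewrite [X in X - _]e addrC addKr.
Qed.

(** * The residual and the Lyapunov function *)

(** Nonexpansiveness of the resolvent: with p the resolvent point and r = y - p,
    monotonicity of B between y and p is 0 <= <d - r, r>. *)
Lemma cnat_residual_le (R : realType) (n : nat) (F : 'rV[R]_n -> 'rV[R]_n)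
    (B : setop R n) (y d : 'rV[R]_n) :
  maximal_monotone B -> B y (d - F y) -> enorm (cnat_residual F B y) <= enorm d.
Proof.
move=> Bmax By; rewrite /cnat_residual.
set p := resolvent _ _; have Bp : B p (y - F y - p) by exact: resolventP.
set r := y - p.
have : dotr r r <= dotr d r.
  have := Bmax.1 _ _ _ _ By Bp.
  rewrite (_ : d - F y - _ = d - r); last first.
    by apply/rowP => i; rewrite !mxE; ring.
  by rewrite -/r dotrDl dotrNl; lra.
rewrite -sqr_enorm => /le_trans/(_ (cauchy_schwarz d r)).
have := enorm_ge0 r; rewrite le_eqVlt => /predU1P[<- _|r0].
  exact: enorm_ge0.
by rewrite expr2 ler_pM2r.
Qed.

(** Expand the monotonicity inequality, writing the increment of y in two ways:
    (1 - t) (y - y') = - t (y - u) - lam d - e against d, and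
    y - y' = - t (y' - u) - lam d - e against d'. With
    g = lam (d - (1 - t) d') the terms left over beyond the claim are
    (|g|^2 + 2 <g, e>) / (2 lam) = (|g + e|^2 - |e|^2) / (2 lam). They have the
    right sign since |e| <= sigma |x - y| and |x - y| <= |g + e|; the latter
    holds because x behaves as the projection of y + g + e onto a convex set
    that contains y. *)
Lemma maeg_step_descent (R : realType) (n : nat) (t lam sigma : R)
    (u y' d' y d x e : 'rV[R]_n) :
  0 < lam -> sigma ^+ 2 <= 1 ->
  y = t *: u + (1 - t) *: y' - lam *: d - e ->
  dotr e e <= sigma ^+ 2 * dotr (x - y) (x - y) ->
  0 <= dotr (t *: u + (1 - t) *: (y' - lam *: d') - x) (x - y) ->
  0 <= (1 - t) * dotr (d - d') (y - y') ->
  t * dotr d (y - u) + lam / 2 * dotr d d <=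
  (1 - t) * (t * dotr d' (y' - u) + lam / 2 * (1 - t) * dotr d' d').
Proof.
move=> lam0 sigma1 ydef e_le proj mono.
pose g := lam *: (d - (1 - t) *: d').
have wE : t *: u + (1 - t) *: (y' - lam *: d') = y + g + e.
  by rewrite ydef; apply/rowP => i; rewrite !mxE; ring.
have ege : dotr e e <= dotr (g + e) (g + e).
  have xy : dotr (x - y) (x - y) <= dotr (g + e) (g + e).
    rewrite (_ : g + e = (y + g + e - x) + (x - y)); last first.
      by apply/rowP => i; rewrite !mxE; ring.
    move: proj; rewrite wE; move: (y + g + e - x) (x - y) => p q proj.
    by have := dotr_ge0 p; rewrite !dotrE (dotrC q p); lra.
  have := dotr_ge0 (x - y); nra.
have eE : e = t *: u + (1 - t) *: y' - lam *: d - y.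
  by rewrite ydef; apply/rowP => i; rewrite !mxE; ring.
have ege' : 0 <= dotr g g + 2 * dotr g e.
  by move: ege; rewrite dotrDl (dotrDr g) (dotrDr e) (dotrC e g); lra.
rewrite -(ler_pM2l lam0).
move: ege' mono; rewrite eE /g !dotrE (dotrC d' d); nra.
Qed.

Lemma sol_dotr_ge0 (R : realType) (n : nat)
    (D : set 'rV[R]_n) (F : 'rV[R]_n -> 'rV[R]_n) (B : setop R n)
    (xs y d : 'rV[R]_n) :
  monotone_on D F -> smonotone B -> Sol D F B xs -> D y -> B y (d - F y) ->
  0 <= dotr d (y - xs).
Proof.
move=> Fmono Bmono [Dxs [bs Bbs bsE]] Dy By.
have := Bmono _ _ _ _ By Bbs; have := Fmono _ _ Dy Dxs.
have -> : bs = - F xs by apply/eqP; rewrite -addr_eq0 addrC -bsE.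
by rewrite !dotrE; lra.
Qed.

Lemma maeg_tau_const (R : realType) (rho lam : R) (k : nat) :
  0 < lam -> maeg_tau rho (fun=> lam) k.+1 = ((1 - 2 * rho) * k%:R + 1)^-1.
Proof.
move=> lam0; rewrite /maeg_tau /maeg_Lambda sumr_const_nat subSS subn0 /=.
rewrite -[lam *+ k]mulr_natl (_ : _ + lam = lam * ((1 - 2 * rho) * k%:R + 1)).
  by rewrite invfM mulrA mulfV ?mul1r // gt_eqF.
by ring.
Qed.

(** One iteration preserves the Lyapunov inequality and does not increase the
    distance from the anchor u to a solution xs. Here b stands for a k, and
    1 - t = b t turns the right-hand side of [maeg_step_descent] into
    b t^2 times the previous Lyapunov value, which is nonpositive. This leaves
    (lam / 2) (b + 1) |d|^2 <= <d, u - y>. Moving the anchor to u' costs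
    rho lam |d|^2, which is why b grows by 1 - 2 rho only. The same inequality
    and <d, y - xs> >= 0 give <d, u - xs> >= rho lam |d|^2, so the anchor step of
    length rho lam along - d does not move away from xs. *)
Lemma maeg_update (R : realType) (n : nat) (lam sigma rho b : R)
    (xs u y' d' x y d e : 'rV[R]_n) :
  let t := (b + 1)^-1 in
  0 < lam -> sigma ^+ 2 <= 1 -> 0 <= rho -> 2 * rho <= 1 -> 0 <= b ->
  y = t *: u + (1 - t) *: y' - lam *: d - e ->
  dotr e e <= sigma ^+ 2 * dotr (x - y) (x - y) ->
  0 <= dotr (t *: u + (1 - t) *: (y' - lam *: d') - x) (x - y) ->
  0 <= b * dotr (d - d') (y - y') ->
  0 <= dotr d (y - xs) ->
  lam / 2 * b * dotr d' d' <= dotr d' (u - y') ->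
  let u' := u - (rho * lam) *: d in
  lam / 2 * (b + (1 - 2 * rho)) * dotr d d <= dotr d (u' - y) /\
  dotr (u' - xs) (u' - xs) <= dotr (u - xs) (u - xs).
Proof.
move=> t lam0 sigma1 rho0 rho1 b0 ydef e_le proj mono xsol inv' u'.
have b1 : 0 < b + 1 by lra.
have t0 : 0 < t by rewrite invr_gt0.
have tb : t * (b + 1) = 1 by rewrite mulVf // gt_eqF.
have tE : 1 - t = b * t by lra.
clearbody t.
have := maeg_step_descent lam0 sigma1 ydef e_le proj.
have -> : 0 <= (1 - t) * dotr (d - d') (y - y').
  by rewrite tE mulrAC mulr_ge0 // ltW.
move=> /(_ isT) desc.
have desc1 : t * dotr d (y - u) + lam / 2 * dotr d d <= 0.
  apply: le_trans desc _; rewrite tE.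
  rewrite [leLHS](_ : _ = b * t ^+ 2 *
    (dotr d' (y' - u) + lam / 2 * b * dotr d' d')); last by ring.
  apply: mulr_ge0_le0; first by rewrite (mulr_ge0 b0) ?sqr_ge0.
  by move: inv'; rewrite !dotrE; lra.
have desc2 : lam / 2 * (b + 1) * dotr d d <= dotr d (u - y).
  rewrite -(ler_pM2l t0) mulrA [t * _]mulrCA tb mulr1.
  by move: desc1; rewrite !dotrE; lra.
have dd := dotr_ge0 d; have lr : 0 <= rho * lam by rewrite mulr_ge0 // ltW.
split; first by move: desc2; rewrite /u' !dotrE; lra.
rewrite (_ : u' - xs = (u - xs) - (rho * lam) *: d); last first.
  by rewrite /u' addrAC.
have desc' : rho * lam * dotr d d <= dotr d (u - xs).
  apply: (@le_trans _ _ (dotr d (u - y))); last first.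
    by move: xsol; rewrite !dotrE; lra.
  apply: le_trans desc2; rewrite ler_wpM2r // [rho * _]mulrC -mulrA.
  by rewrite (ler_wpM2l (ltW lam0)) //; lra.
move: (rho * lam) (u - xs) lr desc' => c v c0 desc'.
have := ler_wpM2l c0 desc'; have := mulr_ge0 (mulr_ge0 c0 c0) dd.
by rewrite !dotrE (dotrC v d); lra.
Qed.

(** At k = 0 the point d_0 = 0 need not be in F(y_0) + B(y_0); this is harmless
    because tau_1 = 1 cancels the term in which y_0 and d_0 occur. *)
Lemma maeg_invariant (R : realType) (n : nat)
    (D : set 'rV[R]_n) (F : 'rV[R]_n -> 'rV[R]_n) (B : setop R n)
    (X : set 'rV[R]_n) (x0 xs : 'rV[R]_n) (sigma rho L : R) (k : nat) :
  monotone_on D F -> maximal_monotone B ->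
  0 < sigma < 1 -> 0 <= rho < 2^-1 ->
  X !=set0 -> closed X -> convex_set X ->
  sdom B `<=` X -> X `<=` D -> Sol D F B xs ->
  0 < L -> elipschitz_on L D F ->
  let: MaegState u y d := maeg F B X rho (fun=> sigma / L) x0 k in
  [/\ (0 < k)%N -> B y (d - F y),
    sigma / L / 2 * ((1 - 2 * rho) * k%:R) * dotr d d <= dotr d (u - y) &
    dotr (u - xs) (u - xs) <= dotr (x0 - xs) (x0 - xs)].
Proof.
move=> Fmono Bmax /andP[s0 s1] /andP[rho0 rho2] X0 Xcl Xcv BX XD xsol L0 Flip.
have lam0 : 0 < sigma / L by rewrite divr_gt0.
have lamL : sigma / L * L = sigma by rewrite divfK // gt_eqF.
set lam := sigma / L in lam0 lamL *.
have Dy z v : B z v -> D z by move=> Bz; apply/XD/BX; exists v.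
elim: k => [|k] /=; first by rewrite !dotr0l mulr0.
case: (maeg _ _ _ _ _ _ k) => u y d [By inv dist] /=.
rewrite maeg_tau_const //; set b := (1 - 2 * rho) * k%:R in inv *.
set t := (b + 1)^-1; set w := t *: u + (1 - t) *: (y - lam *: d).
have [Xx projx] := eprojP w X0 Xcl Xcv; set x := eproj X w in Xx projx *.
set z := t *: u + (1 - t) *: y.
have [v By1 vE] :=
  resolventP (z - lam *: F x) (maximal_monotone_scale lam0 Bmax).
set y1 := resolvent _ _ in By1 vE *.
set d1 := lam^-1 *: (z - y1) - F x + F y1.
have d1E : d1 = v + F y1.
  congr (_ + _); rewrite -[v]scale1r -(mulVf (lt0r_neq0 lam0)) -scalerA vE.
  rewrite -[F x in LHS]scale1r -(mulVf (lt0r_neq0 lam0)) -scalerA -scalerBr.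
  by rewrite addrAC.
have b0 : 0 <= b by rewrite mulr_ge0 //; lra.
have Xy1 : X y1 by apply: BX; exists v.
have [|||||||||||inv1 dist1] :=
  @maeg_update R n lam sigma rho b xs u y d x y1 d1 (lam *: (F x - F y1)).
- exact: lam0.
- by rewrite expr_le1 // ltW.
- exact: rho0.
- by lra.
- exact: b0.
- rewrite -/t -/z d1E scalerDr vE; apply/rowP => i; rewrite !mxE; ring.
- have le1 : lam * enorm (F x - F y1) <= sigma * enorm (x - y1).
    rewrite -lamL -mulrA (ler_wpM2l (ltW lam0)) //.
    exact: Flip (XD _ Xx) (XD _ Xy1).
  have := enorm_ge0 (F x - F y1); have := enorm_ge0 (x - y1).
  rewrite dotrZl dotrZr -!sqr_enorm => h1 h2.
  by rewrite mulrA -expr2 -!exprMn ler_pXn2r // nnegrE mulr_ge0 // ltW.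
- exact: projx.
- have [k0|k0] := posnP k; first by rewrite /b k0 mulr0 mul0r.
  rewrite mulr_ge0 //.
  have := Bmax.1 _ _ _ _ By1 (By k0).
  have := Fmono _ _ (Dy _ _ By1) (Dy _ _ (By k0)).
  by rewrite d1E !dotrE; lra.
- apply: (sol_dotr_ge0 Fmono Bmax.1 xsol (Dy _ _ By1)).
  by rewrite d1E addrK.
- exact: inv.
split=> [_||]; first by rewrite d1E addrK.
- move: inv1; congr (_ <= _); congr (_ * _ * _).
  by rewrite /b -[in RHS](natr1 k) mulrDr mulr1.
- exact: le_trans dist1 dist.
Qed.

Lemma maeg_gradient_le (R : realType) (n : nat)
    (D : set 'rV[R]_n) (F : 'rV[R]_n -> 'rV[R]_n) (B : setop R n)
    (X : set 'rV[R]_n) (x0 xs : 'rV[R]_n) (sigma rho L : R) (k : nat) :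
  monotone_on D F -> maximal_monotone B ->
  0 < sigma < 1 -> 0 <= rho < 2^-1 ->
  X !=set0 -> closed X -> convex_set X ->
  sdom B `<=` X -> X `<=` D -> Sol D F B xs ->
  0 < L -> elipschitz_on L D F -> (0 < k)%N ->
  let y := maeg_y F B X rho (fun=> sigma / L) x0 k in
  let d := maeg_d F B X rho (fun=> sigma / L) x0 k in
  B y (d - F y) /\
  enorm d <= 2 * L * enorm (x0 - xs) / (sigma * (1 - 2 * rho)) * k%:R^-1.
Proof.
move=> Fmono Bmax s01 r01 X0 Xcl Xcv BX XD xsol L0 Flip k0.
have := @maeg_invariant R n D F B X x0 xs sigma rho L k Fmono Bmax s01 r01
  X0 Xcl Xcv BX XD xsol L0 Flip.
rewrite /maeg_y /maeg_d; case: (maeg _ _ _ _ _ _ k) => u y d [/= By inv dist].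
have {}By := By k0; split => //.
case/andP: s01 r01 => s0 s1 /andP[rho0 rho2].
have a0 : 0 < 1 - 2 * rho by lra.
have kR : 0 < k%:R :> R by rewrite ltr0n.
have xmono : 0 <= dotr d (y - xs).
  apply: (sol_dotr_ge0 Fmono Bmax.1 xsol _ By).
  by apply/XD/BX; exists (d - F y).
have : sigma / L / 2 * ((1 - 2 * rho) * k%:R) * enorm d ^+ 2 <=
    enorm d * enorm (x0 - xs).
  rewrite sqr_enorm; apply: le_trans inv _.
  apply: (@le_trans _ _ (dotr d (u - xs))).
    by move: xmono; rewrite !dotrE; lra.
  apply: le_trans (cauchy_schwarz _ _) _; rewrite ler_wpM2l ?enorm_ge0 //.
  by rewrite ler_enorm.
have := enorm_ge0 d; rewrite le_eqVlt => /predU1P[<- _|dp].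
  by rewrite !mulr_ge0 ?invr_ge0 ?mulr_ge0 ?enorm_ge0 ?ltW.
rewrite expr2 mulrA [leRHS]mulrC ler_pM2r // => H.
rewrite -mulrA -invfM ler_pdivlMr ?mulr_gt0 //.
have -> : enorm d * (sigma * (1 - 2 * rho) * k%:R) =
    2 * L * (sigma / L / 2 * ((1 - 2 * rho) * k%:R) * enorm d).
  by field; rewrite gt_eqF.
by rewrite ler_pM2l // mulr_gt0.
Qed.

(** The bound is required for positive indices only, since 0^-1 = 0 by
    convention. *)
Lemma eqO_inv_nat (R : realType) (f : nat -> R) (K : R) :
  (forall k, (0 < k)%N -> `|f k| <= K * k%:R^-1) ->
  f =O_\oo (fun k => k%:R^-1 : R).
Proof.
move=> fK; apply/eqOP; near=> c; near=> k.
apply: (@le_trans _ _ (K * k%:R^-1)).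
  by apply: fK; near: k; exact: nbhs_infty_gt.
rewrite ger0_norm ?invr_ge0 // ler_wpM2r ?invr_ge0 //.
Unshelve. all: by end_near. Qed.

(** * The convergence rate *)

Unset Implicit Arguments.
Set Strict Implicit.
Set Printing Implicit Defensive.

Theorem mainTheorem4 (R : realType) (n : nat)
    (D : set 'rV[R]_n) (F : 'rV[R]_n -> 'rV[R]_n) (B : setop R n)
    (X : set 'rV[R]_n) (x0 : 'rV[R]_n) (sigma rho L : R)
    (F_mono : monotone_on D F)
    (F_cont : {within D, continuous F})
    (B_max : maximal_monotone B)
    (domB_D : closure (sdom B) `<=` D)
    (x0_dom : closure (sdom B) x0)
    (sigma01 : 0 < sigma < 1)
    (rho_itv : 0 <= rho < 2^-1)
    (X_neq0 : X !=set0) (X_closed : closed X) (X_convex : convex_set X)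
    (domB_X : closure (sdom B) `<=` X) (X_D : X `<=` D)
    (Sol_neq0 : Sol D F B !=set0)
    (L_gt0 : 0 < L)
    (F_lip : elipschitz_on L D F) :
  let y k := maeg_y F B X rho (fun=> sigma / L) x0 k in
  let d k := maeg_d F B X rho (fun=> sigma / L) x0 k in
  (fun k => enorm (cnat_residual F B (y k))) =O_\oo (fun k => k%:R^-1 : R) /\
  (fun k => enorm (d k)) =O_\oo (fun k => k%:R^-1 : R).
Proof.
move=> y d; have [xs xsol] := Sol_neq0.
have BX : sdom B `<=` X by move=> z Bz; apply: domB_X; exact: subset_closure.
have bound k := @maeg_gradient_le R n D F B X x0 xs sigma rho L k F_mono B_max
  sigma01 rho_itv X_neq0 X_closed X_convex BX X_D xsol L_gt0 F_lip.
split; apply: eqO_inv_nat => k /bound [By dk]; rewrite ger0_norm ?enorm_ge0 //.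
  by apply: le_trans dk; exact: cnat_residual_le.
exact: dk.
Qed.
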